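(* Consider a real normed space $(Y,\|\cdot\|)$ with dimension two or higher and nontrivial cones $K,A\subseteq Y$ (with the norm-bases $B_K(\|\cdot\|)$ and $B_A(\|\cdot\|)$, respectively). Suppose that $\operatorname{cl}S_{-K}(\|\cdot\|)$ is weakly compact (e.g., if $Y$ is reflexive), and that $$A\cap\operatorname{cl}(\operatorname{conv}(-K))=\{0\}\quad\text{and}\quad 0\notin\operatorname{cl}S_{-K}(\|\cdot\|).$$ Moreover, assume that one of the following is satisfied: (a) $B_A(\|\cdot\|)$ is compact. (b) $A$ is weakly closed, and either $Y$ is reflexive or $\operatorname{cl}_wB_A(\|\cdot\|)$ is weakly compact with $0\notin\operatorname{cl}_wB_A(\|\cdot\|)$. Then there are a norm $\|\cdot\|'$ equivalent to $\|\cdot\|$ and $(x^*,\alpha)\in K^{a\#}(\|\cdot\|')\cap(Y^*\times\mathbb P)$ such that $$A\cap(-C_{\|\cdot\|'}(x^*,\alpha))=\{0\}\quad\text{and}\quad K\setminus\{0\}\subseteq C^>_{\|\cdot\|'}(x^*,\alpha)=\operatorname{cor}C_{\|\cdot\|'}(x^*,\alpha).$$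
   Context: $Y^*$ is the topological dual of $Y$, $\mathbb R_+=[0,\infty)$, $\mathbb P=(0,\infty)$. A set $K\subseteq Y$ is a cone if $0\in K=\mathbb R_+\cdot K$ (not necessarily convex); it is nontrivial if $\{0\}\ne K\ne Y$. For a cone $C$ and a norm $\psi$: $B_C(\psi):=\{x\in C\mid\psi(x)=1\}$ (the norm-base of $C$), $S_C(\psi):=\operatorname{conv}(B_C(\psi))$. $\operatorname{cl}$ is the norm closure and $\operatorname{cl}_w$ the weak closure. $K^{a\#}(\psi):=\{(x^*,\alpha)\in Y^*\times\mathbb R_+\mid\forall y\in K\setminus\{0\}:\ x^*(y)-\alpha\psi(y)>0\}$. $C_\psi(x^*,\alpha):=\{y\in Y\mid x^*(y)\ge\alpha\psi(y)\}$, $C^>_\psi(x^*,\alpha):=\{y\in Y\mid x^*(y)>\alpha\psi(y)\}$. The algebraic interior is $\operatorname{cor}M:=\{x\in M\mid\forall v\in Y\ \exists\varepsilon>0:\ x+[0,\varepsilon]\cdot v\subseteq M\}$. *)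

(* Defs.v *)
(* MathComp / MathComp-Analysis. Cones need not be convex. A norm is passed as
   a bare function [psi : Y -> R], so that two norms can live on one space. *)
From HB Require Import structures.
From mathcomp Require Import all_boot all_order all_algebra.
From mathcomp Require Import all_classical all_reals all_analysis.

Set Warnings "-redundant-canonical-projection,-projection-no-head-constant".
Set Implicit Arguments.
Unset Strict Implicit.
Unset Printing Implicit Defensive.

Import Order.TTheory GRing.Theory Num.Def Num.Theory.
Import numFieldNormedType.Exports.

Local Open Scope classical_set_scope.
Local Open Scope ring_scope.

(* The topological dual, with pointwise operations and the operator norm,
   is again a normed space, so that the bidual is [dual (dual Y)]. *)
Section Dual.
Context {R : realType} (Y : normedModType R).

Definition dual_pred : {pred Y -> R^o} :=
  fun f => `[< linear f /\ continuous f >].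

Record dual := Dual { dual_fun :> Y -> R^o ; dual_funP : dual_fun \in dual_pred }.

HB.instance Definition _ := [isSub for dual_fun].
HB.instance Definition _ := [Choice of dual by <:].

Let dual_submod_closed : submod_closed dual_pred.
Proof.
split=> [|a f g /asboolP[lf cf] /asboolP[lg cg]]; apply/asboolP; split.
- by move=> a x y /=; rewrite scaler0 addr0.
- exact: cst_continuous.
- move=> b x y; rewrite !fctE lf lg !scalerDr !scalerA mulrC.
  by rewrite -!addrA; congr (_ + _); rewrite addrCA.
- by move=> x; apply: cvgD; [apply: cvgZl_tmp; exact: cf|exact: cg].
Qed.

HB.instance Definition _ :=
  GRing.isSubmodClosed.Build R (Y -> R^o) dual_pred dual_submod_closed.
HB.instance Definition _ := [SubChoice_isSubLmodule of dual by <:].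

End Dual.

Section DualFun.
Context {R : realType} {Y : normedModType R}.
Implicit Types f g : dual Y.

Let dual_fun_linear f : linear (f : Y -> R^o).
Proof. by have /asboolP[] := dual_funP f. Qed.

HB.instance Definition _ f :=
  GRing.isLinear.Build R Y R^o *:%R (f : Y -> R^o) (dual_fun_linear f).

Lemma dual_fun_continuous f : continuous (f : Y -> R^o).
Proof. by have /asboolP[] := dual_funP f. Qed.

Lemma dual_funD f g x : (f + g) x = f x + g x.
Proof. by []. Qed.

Lemma dual_funZ (a : R) f x : (a *: f) x = a * f x.
Proof. by []. Qed.

Definition dual_norm f : R := sup [set `|f x| | x in [set x : Y | `|x| <= 1]].

Let dual_norm_has_sup f :
  has_sup [set `|f x| | x in [set x : Y | `|x| <= 1]].
Proof.
split; first by exists `|f 0|, 0 => //=; rewrite normr0.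
have [r fr] : exists r, forall x, `|f x| <= r * `|x|.
  have /linear_boundedP/pinfty_ex_gt0[r _ fr] :=
    @continuous_linear_bounded _ _ _ 0 f (@dual_fun_continuous f 0).
  by exists r.
exists `|r| => _ [x /= x1 <-]; apply: (le_trans (fr x)).
rewrite (le_trans (ler_norm _))// normrM normr_id.
by rewrite -[leRHS]mulr1 ler_wpM2l.
Qed.

Lemma dual_norm_ub f x : `|x| <= 1 -> `|f x| <= dual_norm f.
Proof. by move=> x1; apply: sup_upper_bound => //; exists x. Qed.

Let dual_norm_le f r :
  (forall x, `|x| <= 1 -> `|f x| <= r) -> dual_norm f <= r.
Proof.
move=> fr; apply: ge_sup; first by case: (dual_norm_has_sup f).
by move=> _ [x x1 <-]; exact: fr.
Qed.

Let dual_normD f g : dual_norm (f + g) <= dual_norm f + dual_norm g.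
Proof.
apply: dual_norm_le => x x1; rewrite dual_funD.
by rewrite (le_trans (ler_normD _ _))// lerD// dual_norm_ub.
Qed.

Let dual_norm_ge0 f : 0 <= dual_norm f.
Proof. by rewrite (le_trans (normr_ge0 (f 0)))// dual_norm_ub// normr0. Qed.

Let dual_normZ_le (a : R) f : dual_norm (a *: f) <= `|a| * dual_norm f.
Proof.
by apply: dual_norm_le => x x1; rewrite normrM ler_wpM2l// dual_norm_ub.
Qed.

Let dual_normZ (a : R) f : dual_norm (a *: f) = `|a| * dual_norm f.
Proof.
apply/eqP; rewrite eq_le dual_normZ_le/=.
have [->|a0] := eqVneq a 0; first by rewrite normr0 mul0r dual_norm_ge0.
rewrite -ler_pdivlMl ?normr_gt0// -normfV.
by rewrite -[X in dual_norm X <= _](scalerK a0) dual_normZ_le.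
Qed.

Let dual_norm_eq0 f : dual_norm f = 0 -> f = 0.
Proof.
move=> f0; apply/val_inj/funext => x.
have [->|x0] := eqVneq x 0; first exact: linear0.
have : `|f (`|x|^-1 *: x)| <= 0.
  by rewrite -f0 dual_norm_ub// normrZ normfV normr_id mulVf// normr_eq0.
rewrite normr_le0 linearZ/= scaler_eq0 invr_eq0 normr_eq0 (negbTE x0)/=.
by move/eqP.
Qed.

HB.instance Definition _ :=
  Lmodule_isNormed.Build R (dual Y) dual_normD dual_normZ dual_norm_eq0.

End DualFun.

Lemma dual_normE {R : realType} {Y : normedModType R} (f : dual Y) :
  `|f| = dual_norm f.
Proof. by []. Qed.

Definition reflexive_space {R : realType} (Y : normedModType R) : Prop :=
  forall phi : dual (dual Y), exists y : Y, forall f : dual Y, phi f = f y.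

Section WeakTopology.
Context {R : realType} (Y : normedModType R).

(* Y with the coarsest topology making every element of the dual continuous. *)
Definition weak : topologicalType :=
  sup_topology (fun f : dual Y =>
    Topological.on (initial_topology (f : Y -> R^o))).

Definition weakly_compact (S : set Y) : Prop := @compact weak S.
Definition weakly_closed (S : set Y) : Prop := @closed weak S.
Definition weak_closure (S : set Y) : set Y := @closure weak S.

End WeakTopology.

Section Norms.
Context {R : realType} {Y : lmodType R}.
Implicit Types psi phi : Y -> R.

Definition is_norm psi : Prop :=
  [/\ forall x y, psi (x + y) <= psi x + psi y,
      forall (a : R) x, psi (a *: x) = `|a| * psi x
    & forall x, psi x = 0 -> x = 0].

Definition equivalent_norms psi phi : Prop :=
  exists c C : R, [/\ 0 < c, 0 < C
    & forall y, c * phi y <= psi y /\ psi y <= C * phi y].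

End Norms.

Section Cones.
Context {R : realType} {Y : lmodType R}.
Implicit Types (K M : set Y) (psi : Y -> R).

(* The dimension may be infinite. *)
Definition dim_ge2 (V : lmodType R) : Prop :=
  exists u v : V, forall a b : R, a *: u + b *: v = 0 -> a = 0 /\ b = 0.

Definition is_cone K : Prop :=
  K 0 /\ [set t *: x | t in [set t : R | 0 <= t] & x in K] = K.

Definition nontrivial K : Prop := [set 0] <> K /\ K <> setT.

Definition convex_hull M : set Y := smallest (@convex_set R Y) M.

Definition norm_base K psi : set Y := [set x | K x /\ psi x = 1].

(* S_C(psi), the convex hull of B_C(psi). *)
Definition norm_base_conv K psi : set Y := convex_hull (norm_base K psi).

(* The algebraic interior, often called the core. *)
Definition cor M : set Y :=
  [set x | M x /\ forall v : Y, exists2 e : R, 0 < e &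
    forall t : R, 0 <= t -> t <= e -> M (x + t *: v)].

End Cones.

Section BishopPhelps.
Context {R : realType} {Y : normedModType R}.
Implicit Types (K : set Y) (psi : Y -> R) (f : dual Y) (alpha : R).

(* K^{a#}(psi); nonnegativity of p.2 encodes the factor R_+. *)
Definition aug_dual_cone K psi : set (dual Y * R) :=
  [set p : dual Y * R |
    0 <= p.2 /\ forall y, (K `\ 0) y -> 0 < p.1 y - p.2 * psi y].

(* C_psi(f, alpha), and C^>_psi(f, alpha) below. *)
Definition bp_cone psi f alpha : set Y := [set y | alpha * psi y <= f y].

Definition bp_cone_strict psi f alpha : set Y := [set y | alpha * psi y < f y].

End BishopPhelps.

(* Main.v *)
(* Write P = - K, let S be the convex hull of the norm-base of P, C the convex
   cone generated by S, and d_C the distance to C. Hahn-Banach gives f in Y^*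
   and c > 0 with f >= c |.| on C. The hypotheses on A provide an angle between
   A and C, i.e., e > 0 with d_C >= e |.| on A: in case (a) by compactness, in
   case (b) because a weakly closed set and a disjoint weakly compact set are
   separated by a norm ball. The function
     psi y = max (f y + c d_C y) (- f y + c d_C (- y))
   is an equivalent norm, since C is a normal cone; it equals f on C, and
   psi >= f + c e |.| on A. Hence, for alpha < 1 close to 1, f > alpha psi on
   C minus 0 and f < alpha psi on A minus 0, so that x^* = - f works. *)
Require Import Defs.
From HB Require Import structures.
From mathcomp Require Import all_boot all_order all_algebra.
From mathcomp Require Import all_classical all_reals all_analysis.
From mathcomp Require Import ring lra.

Import Order.TTheory GRing.Theory Num.Def Num.Theory.
Import numFieldNormedType.Exports.

Local Open Scope classical_set_scope.
Local Open Scope ring_scope.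

(** * Sublinear functions and the Hahn-Banach theorem *)

Section Sublinear.
Context {R : realType} {V : lmodType R}.
Implicit Types (p q : V -> R) (G : set (V * R)) (C : set V).

(** Homogeneity is only asked as an inequality; applying it to [t] and to its inverse gives equality
    for [t > 0], and [t = 0] together with subadditivity forces [q 0 = 0]. *)
Definition sublinear q : Prop :=
  (forall x y, q (x + y) <= q x + q y) /\
  (forall t x, 0 <= t -> q (t *: x) <= t * q x).

Lemma sublinear0 q : sublinear q -> q 0 = 0.
Proof.
move=> [qD qZ]; have := qD 0 0; have := qZ 0 0 (lexx 0).
by rewrite scale0r mul0r addr0; lra.
Qed.

Lemma sublinearZ q t x : sublinear q -> 0 <= t -> q (t *: x) = t * q x.
Proof.
move=> sq; rewrite le_eqVlt => /predU1P[<-|t0].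
  by rewrite scale0r mul0r sublinear0.
apply/eqP; rewrite eq_le (proj2 sq _ _ (ltW t0))/= -ler_pdivlMl//.
rewrite -[in leLHS](scalerK (lt0r_neq0 t0) x).
by apply: (proj2 sq); rewrite invr_ge0 ltW.
Qed.

Lemma sublinearN_ge q x : sublinear q -> - q (- x) <= q x.
Proof.
move=> sq; have := proj1 sq x (- x).
by rewrite subrr sublinear0// ; lra.
Qed.

(* The infimal convolution of [q] with the function whose graph is [G]. *)
Definition infconv q G y : R := inf [set q (y - g.1) + g.2 | g in G].

Definition convex_cone C : Prop :=
  [/\ C 0, forall x y, C x -> C y -> C (x + y)
    & forall (t : R) x, 0 <= t -> C x -> C (t *: x)].

Definition graph_cone G : Prop :=
  [/\ G (0, 0), forall g h, G g -> G h -> G (g.1 + h.1, g.2 + h.2)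
    & forall (t : R) g, 0 <= t -> G g -> G (t *: g.1, t * g.2)].

Section Infconv.
Context (q : V -> R) (G : set (V * R)) (sq : sublinear q) (cG : graph_cone G)
  (qG : forall g, G g -> 0 <= q (- g.1) + g.2).

(** [qG] bounds the competitors at the origin; subadditivity along [- g.1 = - y + (y - g.1)] carries
    the bound to every [y], so that the infimum in [infconv] is taken over a set bounded below. *)
Lemma infconv_lbound y : lbound [set q (y - g.1) + g.2 | g in G] (- q (- y)).
Proof.
move=> _ [g Gg <-]; have := qG _ Gg; have := proj1 sq (- y) (y - g.1).
by rewrite addKr; lra.
Qed.

Lemma infconv_le y g : G g -> infconv q G y <= q (y - g.1) + g.2.
Proof.
move=> Gg; apply: ge_inf; last by exists g.
by exists (- q (- y)); exact: infconv_lbound.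
Qed.

Lemma infconv_ge y r :
  (forall g, G g -> r <= q (y - g.1) + g.2) -> r <= infconv q G y.
Proof.
move=> h; apply: lb_le_inf; last by move=> _ [g Gg <-]; exact: h.
by exists (q (y - 0) + 0), (0, 0) => //; case: cG.
Qed.

Lemma infconv_le_self y : infconv q G y <= q y.
Proof.
have /= := @infconv_le y (0, 0) _; rewrite subr0 addr0; apply.
by case: cG.
Qed.

(** Competitors for [x] and [y] add up inside [G] to a competitor for [x + y], and a competitor for
    [x] rescales by [t > 0]. *)
Lemma infconv_sublinear : sublinear (infconv q G).
Proof.
have [G0 GD GZ] := cG; split=> [x y|t x].
  rewrite -lerBlDl; apply: infconv_ge => h Gh.
  rewrite lerBlDr -lerBlDl; apply: infconv_ge => g Gg.
  have /= := @infconv_le (x + y) _ (GD _ _ Gg Gh).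
  have := proj1 sq (x - g.1) (y - h.1); rewrite addrACA -opprD.
  by lra.
rewrite le_eqVlt => /predU1P[<-|t0].
  rewrite mul0r scale0r (le_trans (infconv_le_self _))//.
  by rewrite sublinear0.
rewrite -ler_pdivrMl//; apply: infconv_ge => g Gg; rewrite ler_pdivrMl//.
rewrite (le_trans (infconv_le _ _ (GZ _ _ (ltW t0) Gg)))//=.
by rewrite -scalerBr (sublinearZ _ _ _ sq (ltW t0)) mulrDr.
Qed.

End Infconv.

(** Zorn's lemma: the pointwise infimum of a nonempty chain of sublinear functions below [p] is
    again sublinear. *)
Lemma minimal_sublinear p : sublinear p ->
  exists q, [/\ sublinear q, forall x, q x <= p x &
    forall r, sublinear r -> (forall x, r x <= q x) -> r = q].
Proof.
move=> sp; pose T := {q : V -> R | sublinear q /\ forall x, q x <= p x}.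
(* The order is reversed, so that a maximal element for [r] is a pointwise minimal function. *)
pose r (s t : T) := `[< forall x, sval t x <= sval s x >].
have p0 : T by exists p.
have [||A Atot|t tmax] := @ZL_preorder T p0 r.
- by move=> t; apply/asboolP.
- move=> s t u /asboolP st /asboolP tu; apply/asboolP => x.
  exact: le_trans (tu x) (st x).
- have [[a0 Aa0]|A0] := pselect (A !=set0); last first.
    by exists p0 => s As; exfalso; apply: A0; exists s.
  pose m x := inf [set sval s x | s in A].
  (* The bound [- p (- x)] does not depend on the member of the chain, which keeps the infimum [m x]
     finite. *)
  have lbm x : lbound [set sval s x | s in A] (- p (- x)).
    move=> _ [s As <-]; have [ss sp'] := svalP s.
    by rewrite (le_trans _ (sublinearN_ge _ x ss))// lerN2.
  have mle s x : A s -> m x <= sval s x.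
    by move=> As; apply: ge_inf; [exists (- p (- x)); exact: lbm|exists s].
  have mge c x : (forall s, A s -> c <= sval s x) -> c <= m x.
    move=> h; apply: lb_le_inf; first by exists (sval a0 x), a0.
    by move=> _ [s As <-]; exact: h.
  have sm : sublinear m.
    split=> [x y|t x].
      rewrite -lerBlDl; apply: (mge) => s As; rewrite lerBlDr -lerBlDl.
      apply: (mge) => u Au; rewrite lerBlDr.
      (* Of two members of a chain, the smaller one bounds both summands at once. *)
      have key w : A w -> sval w x <= sval u x -> sval w y <= sval s y ->
          m (x + y) <= sval u x + sval s y.
        move=> Aw wu ws; rewrite (le_trans (mle _ _ Aw))//.
        have [[wD _] _] := svalP w.
        by rewrite (le_trans (wD _ _))// lerD.
      by case: (Atot _ _ As Au) => /asboolP h; [exact: (key u)|exact: (key s)].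
    rewrite le_eqVlt => /predU1P[<-|t0].
      rewrite mul0r scale0r (le_trans (mle _ _ Aa0))//.
      by rewrite sublinear0//; case: (svalP a0).
    rewrite -ler_pdivrMl//; apply: (mge) => s As; rewrite ler_pdivrMl//.
    rewrite (le_trans (mle _ _ As))//.
    by have [[_ sZ] _] := svalP s; rewrite sZ// ltW.
  have mp x : m x <= p x.
    by rewrite (le_trans (mle _ _ Aa0))//; case: (svalP a0).
  by exists (exist _ m (conj sm mp)) => s As; apply/asboolP => x; exact: mle.
exists (sval t); have [st tp] := svalP t; split=> // u su ut.
have up x : u x <= p x by exact: le_trans (ut x) (tp x).
have /asboolP h := tmax (exist _ u (conj su up)) (introT (asboolP _) ut).
by apply/funext => x; apply/eqP; rewrite eq_le ut/=; exact: h.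
Qed.

(* A minimal sublinear [q] equals its infimal convolution along the ray [t x],
   whence [q (- x) = - q x]. *)
Lemma hahn_banach p : sublinear p -> exists g : V -> R,
  (forall a x y, g (a *: x + y) = a * g x + g y) /\ forall x, g x <= p x.
Proof.
move=> /minimal_sublinear[q [sq qp qmin]].
have qN x : q (- x) = - q x.
  (* On this ray [q (- g.1) + g.2] is [q (t *: x) - t * q x], which vanishes. *)
  pose G := [set g : V * R | exists2 t : R, 0 <= t &
    g = (- (t *: x), - (t * q x))].
  have cG : graph_cone G.
    split=> [|_ _ [s s0 ->] [t t0 ->]|s _ s0 [t t0 ->]].
    - by exists 0; rewrite // scale0r mul0r !oppr0.
    - exists (s + t); first exact: addr_ge0.
      by rewrite /= scalerDl mulrDl !opprD.
    - exists (s * t); first exact: mulr_ge0.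
      by rewrite /= scalerN mulrN scalerA mulrA.
  have qG g : G g -> 0 <= q (- g.1) + g.2.
    by move=> [t t0 ->]/=; rewrite opprK sublinearZ// subrr.
  have e : infconv q G = q.
    apply: qmin; first exact: infconv_sublinear.
    by move=> y; exact: infconv_le_self.
  have Gx : G (- x, - q x) by exists 1; rewrite ?scale1r ?mul1r.
  have := infconv_le _ _ sq qG (- x) _ Gx.
  rewrite e /= opprK addNr sublinear0// sub0r.
  by have := sublinearN_ge _ x sq; lra.
(* Oddness turns subadditivity at [- x] and [- y] into the reverse inequality. *)
have qD x y : q (x + y) = q x + q y.
  have := proj1 sq x y; have := proj1 sq (- x) (- y).
  by rewrite -opprD !qN; lra.
exists q; split=> // a x y; rewrite qD; congr (_ + _).
have [a0|a0] := leP 0 a; first exact: sublinearZ.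
rewrite -[a]opprK scaleNr qN mulNr; congr (- _); apply: sublinearZ => //.
by rewrite oppr_ge0 ltW.
Qed.

End Sublinear.

(** * Convex hulls and cones *)

Section ConvexSets.
Context {R : realType} {V : lmodType R}.
Implicit Types (M C : set V) (x y : V) (t : R).

Lemma convex_setP M : @convex_set R V M <->
  forall x y t, 0 <= t -> t <= 1 -> M x -> M y -> M (t *: x + (1 - t) *: y).
Proof.
split=> [cM x y t t0 t1 Mx My|cM x y l /set_mem Mx /set_mem My].
  have := cM x y (Itv01 t0 t1) (mem_set Mx) (mem_set My).
  by rewrite inE.
by apply/mem_set; exact: cM.
Qed.

Lemma convex_hull_sub M : M `<=` convex_hull M.
Proof. exact: sub_gen_smallest. Qed.

Lemma convex_hull_min M N : M `<=` N ->
  (forall x y t, 0 <= t -> t <= 1 -> N x -> N y -> N (t *: x + (1 - t) *: y)) ->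
  convex_hull M `<=` N.
Proof. by move=> MN /convex_setP cN; exact: smallest_sub. Qed.

Lemma convex_convex_hull M x y t : 0 <= t -> t <= 1 ->
  convex_hull M x -> convex_hull M y -> convex_hull M (t *: x + (1 - t) *: y).
Proof.
move=> t0 t1 Mx My N [cN MN]; move/convex_setP : (cN); apply=> //.
  exact: Mx.
exact: My.
Qed.

Lemma convex_hull_scale M r : (forall x, M x -> M (r *: x)) ->
  forall x, convex_hull M x -> convex_hull M (r *: x).
Proof.
move=> Mr; apply: convex_hull_min => [x Mx|x y t t0 t1].
  by apply: convex_hull_sub; exact: Mr.
rewrite scalerDr !scalerA ![r * _]mulrC -!scalerA.
exact: convex_convex_hull.
Qed.

Lemma convex_comb M s t x y : @convex_set R V M -> 0 <= s -> 0 <= t ->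
  M x -> M y -> exists2 z, M z & s *: x + t *: y = (s + t) *: z.
Proof.
move=> /convex_setP cM s0 t0 Mx My.
have [st0|st0] := eqVneq (s + t) 0.
  have [-> ->] : s = 0 /\ t = 0 by lra.
  by exists x; rewrite // addr0 !scale0r addr0.
have st : 0 < s + t by rewrite lt_neqAle eq_sym st0 addr_ge0.
exists ((s / (s + t)) *: x + (1 - s / (s + t)) *: y).
  apply: cM => //; first by rewrite divr_ge0// ltW.
  by rewrite ler_pdivrMr// mul1r lerDl.
by rewrite scalerDr !scalerA; congr (_ *: _ + _ *: _); field.
Qed.

(** For a nonempty convex [M] this is already the convex cone generated by [M]: by [convex_comb],
    sums bring nothing new. *)
Definition cone_of M : set V :=
  [set z | exists2 t, 0 <= t & exists2 x, M x & z = t *: x].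

Lemma convex_cone_cone_of M : @convex_set R V M -> M !=set0 ->
  convex_cone (cone_of M).
Proof.
move=> cM [x0 Mx0].
split=> [|_ _ [s s0 [x Mx ->]] [t t0 [y My ->]]|s _ s0 [t t0 [x Mx ->]]].
- by exists 0 => //; exists x0; rewrite ?scale0r.
- have [z Mz ->] := convex_comb M s t x y cM s0 t0 Mx My.
  by exists (s + t); [exact: addr_ge0|exists z].
- by exists (s * t); [exact: mulr_ge0|exists x; rewrite ?scalerA].
Qed.

Lemma is_cone_scale M t x : is_cone M -> 0 <= t -> M x -> M (t *: x).
Proof.
move=> [_ <-] t0 [s s0 [y My <-]]; rewrite scalerA.
by exists (t * s); [exact: mulr_ge0|exists y].
Qed.

End ConvexSets.

(** * Bounded functionals, and separation from compact and weakly compact sets *)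

Section Normed.
Context {R : realType} {Y : normedModType R}.
Implicit Types (M S A B : set Y) (x y z : Y).

Lemma sublinear_norm : sublinear (fun y : Y => `|y|).
Proof.
split=> [x y|t x t0]; first exact: ler_normD.
by rewrite normrZ ger0_norm.
Qed.

Lemma dual_bound (f : dual Y) :
  exists2 L, 0 < L & forall x, `|f x| <= L * `|x|.
Proof.
have /linear_boundedP/pinfty_ex_gt0[r r0 fr] :=
    @continuous_linear_bounded _ _ _ 0 f (@dual_fun_continuous _ _ f 0).
by exists r.
Qed.

(** The one-sided bound at [- x] gives the missing half of a bound on the absolute value, and a
    bounded linear map is continuous. *)
Lemma dual_of_le_norm (g : Y -> R) :
  (forall a x y, g (a *: x + y) = a * g x + g y) ->
  (forall x, g x <= `|x|) -> exists f : dual Y, forall x, f x = g x.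
Proof.
move=> gl gn.
have lg : linear (g : Y -> R^o) by move=> a x y; exact: gl.
pose gL : {linear Y -> R^o} := HB.pack (g : Y -> R^o)
  (GRing.isLinear.Build R Y R^o *:%R (g : Y -> R^o) lg).
have gle x : `|gL x| <= `|x|.
  have gN : g (- x) = - g x by exact: (linearN gL).
  by rewrite ler_norml gn andbT lerNl -gN -normrN gn.
have cg : continuous (gL : Y -> R^o).
  apply: bounded_linear_continuous; apply/linear_boundedP.
  apply: filterS (nbhs_pinfty_ge (num_real (1 : R))) => r r1 x.
  by rewrite (le_trans (gle x))// ler_peMl.
by exists (Dual (introT (asboolP _) (conj lg cg))).
Qed.

Lemma closureNE M x : ~ closure M x ->
  exists2 d, 0 < d & forall z, M z -> d <= `|x - z|.
Proof.
move=> /existsNP[B /not_implyP[/nbhs_ballP[d /= d0 dB] MB]].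
exists d => // z Mz; rewrite leNgt; apply/negP => xz; apply: MB; exists z.
by split=> //; apply: dB; rewrite -ball_normE.
Qed.

Lemma compact_separation (B M : set Y) : compact B ->
  (forall b, B b -> ~ closure M b) ->
  exists2 d, 0 < d & forall b z, B b -> M z -> d <= `|b - z|.
Proof.
move=> /compact_near_coveringP cB BM.
pose P (e : R) b := forall z, M z -> e <= `|b - z|.
have : \forall e \near 0^'+, B `<=` P e.
  apply: cB => b /BM/closureNE[d d0 dM].
  have d2 : 0 < d / 2 by rewrite divr_gt0.
  (* Within [d / 2] of [b] the distance to [M] is still more than [d / 2]; compactness then makes
     the local radii uniform. *)
  exists (ball b (d / 2), [set e | e < d / 2]) => /=.
    by split; [exact: nbhsx_ballx|exact: nbhs_right_lt].
  move=> [x e] [/=]; rewrite -ball_normE /= => bx ed z Mz.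
  have := dM z Mz; have := ler_normD (b - x) (x - z).
  by rewrite addrA subrK; lra.
move=> BP; near (0 : R)^'+ => e.
exists e; first by near: e; exact: nbhs_right_gt.
have eP : B `<=` P e by near: e.
by move=> b z Bb; exact: eP.
Unshelve. all: by end_near. Qed.

Lemma cvg_weak {T : Type} (F : set_system T) (u : T -> Y) x : Filter F ->
  (u @ F --> (x : weak Y)) <-> forall f : dual Y, f (u t) @[t --> F] --> f x.
Proof.
move=> FF; split.
  move=> /cvg_sup ux f.
  exact: (cvg_comp _ _ (ux f) (@initial_continuous _ _ (f : Y -> R^o) x)).
move=> uf; apply/cvg_sup => f B [_ [[C Co <-] /= Cfx] CB].
rewrite nbhs_filterE; apply: filterS CB _; apply: (uf f C).
exact: open_nbhs_nbhs.
Qed.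

(** The complement of [A] is a weak neighbourhood of each [s] in [S], so [s' + v] avoids [A] for
    [s'] weakly near [s] and [v] small in norm. Weak compactness of [S] gives one radius for [v],
    and [v = a - s] would violate it if [a] were too close to [s]. *)
Lemma weak_separation (S A : set Y) : weakly_compact S -> weakly_closed A ->
  A `&` S = set0 ->
  exists2 d, 0 < d & forall a s, A a -> S s -> d <= `|a - s|.
Proof.
move=> /compact_near_coveringP cS cA AS0.
(* Addition is continuous from [weak Y * Y] to [weak Y]. *)
have addc (s : Y) : (p.1 + p.2 : weak Y)
    @[p --> filter_prod (nbhs (s : weak Y)) (nbhs (0 : Y))] --> (s : weak Y).
  apply/cvg_weak => f.
  rewrite -[f s]addr0 -(linear0 f).
  under eq_cvg do rewrite linearD.
  apply: cvgD.
    apply: (cvg_comp _ _ cvg_fst).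
    have : (id : Y -> Y) @ nbhs (s : weak Y) --> (s : weak Y) by exact: cvg_id.
    by move=> /cvg_weak; apply.
  by apply: (cvg_comp _ _ cvg_snd); exact: dual_fun_continuous.
have : \forall v \near (0 : Y), S `<=` [set s | ~ A (s + v)].
  apply: (cS _ (nbhs (0 : Y)) (fun v s => ~ A (s + v))) => s Ss.
  have nA : nbhs (s : weak Y) (~` A).
    apply: open_nbhs_nbhs; split; first by rewrite openC.
    by move=> As; suff : set0 s by []; rewrite -AS0.
  exact: (addc s _ nA).
move=> /nbhs_ballP[d /= d0 dS]; exists d => // a s Aa Ss.
rewrite leNgt; apply/negP => as_d; apply: (dS (a - s) _ s Ss).
  by rewrite -ball_normE /= sub0r normrN.
by rewrite addrC subrK.
Qed.

End Normed.

(** * Separation *)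

Section Separation.
Context {R : realType} {Y : normedModType R}.
Implicit Types (M C S A : set Y) (x y z : Y).

(* Hahn-Banach is applied to the infimum of [|y + t s| - t d] over [t >= 0] and
   [s] in [S], which is at most [- d] at [- s]. *)
Lemma convex_separation0 S d : @convex_set R Y S ->
  (forall s, S s -> d <= `|s|) ->
  exists f : dual Y, forall s, S s -> d <= f s.
Proof.
move=> cS Sd; have [[s0 Ss0]|S0] := pselect (S !=set0); last first.
  by exists 0 => s Ss; exfalso; apply: S0; exists s.
pose G := [set g : Y * R | exists2 t, 0 <= t &
  exists2 s, S s & g = (- (t *: s), - (t * d))].
have cG : graph_cone G.
  split=> [|_ _ [r r0 [x Sx ->]] [t t0 [y Sy ->]]|r _ r0 [t t0 [s Ss ->]]].
  - by exists 0 => //; exists s0; rewrite // scale0r mul0r !oppr0.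
  - have [z Sz e] := convex_comb S r t x y cS r0 t0 Sx Sy.
    exists (r + t); first exact: addr_ge0.
    by exists z => //=; rewrite -e mulrDl !opprD.
  - exists (r * t); first exact: mulr_ge0.
    by exists s => //=; rewrite scalerN mulrN scalerA mulrA.
have qG g : G g -> 0 <= `|- g.1| + g.2.
  move=> [t t0 [s Ss ->]] /=.
  by rewrite opprK normrZ ger0_norm// -mulrBr mulr_ge0// subr_ge0 Sd.
have [g [gl gp]] := hahn_banach _ (infconv_sublinear _ _ sublinear_norm cG qG).
have [f fg] : exists f : dual Y, forall x, f x = g x.
  apply: dual_of_le_norm => // x; apply: le_trans (gp x) _.
  exact: infconv_le_self sublinear_norm cG qG x.
exists f => s Ss; rewrite -lerN2; have := gp (- s); rewrite -fg linearN.
move=> /le_trans; apply.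
have Gs : G (- s, - d) by exists 1 => //; exists s; rewrite ?scale1r ?mul1r.
apply: le_trans (infconv_le _ _ sublinear_norm qG _ _ Gs) _.
by rewrite /= opprK addNr normr0 add0r.
Qed.

End Separation.

(** * The norm of the Bishop-Phelps cone *)

Section BishopPhelpsNorm.
Context {R : realType} {Y : normedModType R}.
Context (C : set Y) (f : dual Y) (c : R) (cC : convex_cone C) (c0 : 0 < c)
  (fC : forall y, C y -> c * `|y| <= f y).

(** The indicator function of [C] has graph [C] times zero over its domain; writing the distance as
    an infimal convolution lets it inherit sublinearity. *)
Definition cone_dist y : R := infconv (fun y : Y => `|y|) (C `*` [set 0]) y.

Definition bp_norm y : R :=
  Num.max (f y + c * cone_dist y) (- f y + c * cone_dist (- y)).

Let cG : graph_cone (C `*` [set 0 : R]).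
Proof.
have [C0 CD CZ] := cC.
split=> [//|[x r] [y s] [/= Cx ->] [/= Cy ->]|t [x r] t0 [/= Cx ->]].
  by split=> /=; [exact: CD|rewrite addr0].
by split=> /=; [exact: CZ|rewrite mulr0].
Qed.

Let qG (g : Y * R) : (C `*` [set 0]) g -> 0 <= `|- g.1| + g.2.
Proof. by case: g => x r [/= _ ->]; rewrite addr0. Qed.

Let sd : sublinear cone_dist.
Proof. exact: infconv_sublinear sublinear_norm cG qG. Qed.

Lemma cone_dist_le y z : C z -> cone_dist y <= `|y - z|.
Proof.
move=> Cz; have /= := infconv_le _ _ sublinear_norm qG y (z, 0).
by rewrite addr0; apply.
Qed.

Lemma cone_dist_ge y r : (forall z, C z -> r <= `|y - z|) -> r <= cone_dist y.
Proof.
move=> h; apply: (infconv_ge _ _ cG) => -[z s] [/= Cz ->]; rewrite addr0.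
exact: h.
Qed.

Lemma cone_dist_ge0 y : 0 <= cone_dist y.
Proof. exact: cone_dist_ge. Qed.

Lemma cone_dist_le_norm y : cone_dist y <= `|y|.
Proof. by rewrite -[y in leRHS]subr0 cone_dist_le//; case: cC. Qed.

Lemma cone_dist0 y : C y -> cone_dist y = 0.
Proof.
move=> Cy; apply/eqP; rewrite eq_le cone_dist_ge0 andbT.
by rewrite (le_trans (cone_dist_le y y Cy))// subrr normr0.
Qed.

Lemma bp_normN y : bp_norm (- y) = bp_norm y.
Proof. by rewrite /bp_norm linearN !opprK maxC. Qed.

Lemma bp_norm_sublinear : sublinear bp_norm.
Proof.
have [dD dZ] := sd; split=> [x y|t x t0].
  rewrite ge_max; apply/andP; split.
    have : c * cone_dist (x + y) <= c * (cone_dist x + cone_dist y).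
      by rewrite ler_pM2l// dD.
    have : f x + c * cone_dist x <= bp_norm x by rewrite le_max lexx.
    have : f y + c * cone_dist y <= bp_norm y by rewrite le_max lexx.
    by rewrite linearD/=; lra.
  have : c * cone_dist (- (x + y)) <= c * (cone_dist (- x) + cone_dist (- y)).
    by rewrite ler_pM2l// opprD dD.
  have : - f x + c * cone_dist (- x) <= bp_norm x by rewrite le_max lexx orbT.
  have : - f y + c * cone_dist (- y) <= bp_norm y by rewrite le_max lexx orbT.
  by rewrite linearD/=; lra.
rewrite /bp_norm -scalerN !(sublinearZ _ _ _ sd t0) linearZ/=.
rewrite !mulrA ![c * t]mulrC -!mulrA -[_ *: f x]/(t * f x) -mulrN -!mulrDr.
by rewrite maxr_pMr.
Qed.

Lemma bp_norm_le : exists2 k, 0 < k & forall y, bp_norm y <= k * `|y|.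
Proof.
have [L L0 fL] := dual_bound f; exists (L + c); first exact: addr_gt0.
move=> y; rewrite ge_max mulrDl; apply/andP; split; apply: lerD.
- exact: le_trans (ler_norm _) (fL y).
- by rewrite ler_pM2l// cone_dist_le_norm.
- by rewrite (le_trans _ (fL y))// -normrN ler_norm.
- by rewrite ler_pM2l// -normrN cone_dist_le_norm.
Qed.

(* [C] is normal: if [z, w] lie in [C] then [c |z| <= f z <= f (z + w)]. *)
Lemma norm_le_cone_dist : exists2 k, 0 < k &
  forall y, `|y| <= k * (cone_dist y + cone_dist (- y)).
Proof.
have [L L0 fL] := dual_bound f.
have k0 : 0 < 1 + L / c by rewrite addr_gt0// divr_gt0.
exists (1 + L / c) => // y; rewrite -ler_pdivrMl// -lerBlDr.
(* Both distances are infima; they are unfolded one after the other, leaving fixed [z] and [w] in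
   [C] that approximate [y] and [- y]. *)
apply: cone_dist_ge => z Cz; rewrite lerBlDr -lerBlDl.
apply: cone_dist_ge => w Cw; rewrite lerBlDl ler_pdivrMl//.
(* [z + w] is the opposite of the sum of the two residuals [y - z] and [- y - w]. *)
have zw : `|z + w| <= `|y - z| + `|- y - w|.
  have := ler_normD (y - z) (- y - w).
  by rewrite addrACA subrr add0r -opprD normrN.
have zL : `|z| <= L / c * (`|y - z| + `|- y - w|).
  rewrite mulrAC ler_pdivlMr// mulrC (le_trans (fC z Cz))//.
  apply: le_trans (_ : f (z + w) <= _).
    by rewrite linearD/= lerDl (le_trans _ (fC w Cw))// mulr_ge0// ltW.
  rewrite (le_trans (ler_norm _))// (le_trans (fL _))//.
  by rewrite ler_pM2l.
have := ler_normD (y - z) z; rewrite subrK.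
by have := normr_ge0 (- y - w); rewrite mulrDl mul1r; lra.
Qed.

(** Adding the two branches of the maximum cancels [f] and leaves [c] times the sum of the distances
    of [y] and [- y], which dominates the norm because [C] is normal. *)
Lemma bp_norm_ge : exists2 k, 0 < k & forall y, k * `|y| <= bp_norm y.
Proof.
have [k k0 hk] := norm_le_cone_dist.
exists (c / (2 * k)); first by rewrite divr_gt0// mulr_gt0.
move=> y; rewrite mulrAC ler_pdivrMr ?mulr_gt0//.
have h1 : f y + c * cone_dist y <= bp_norm y by rewrite le_max lexx.
have h2 : - f y + c * cone_dist (- y) <= bp_norm y by rewrite le_max lexx orbT.
have h3 : c * `|y| <= c * (k * (cone_dist y + cone_dist (- y))).
  by rewrite ler_pM2l.
have h4 : k * (c * (cone_dist y + cone_dist (- y))) <= k * (2 * bp_norm y).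
  by rewrite ler_pM2l//; lra.
lra.
Qed.

Lemma bp_norm_is_norm : is_norm bp_norm.
Proof.
have sp := bp_norm_sublinear; split=> [|a x|x x0]; first by case: sp.
  have [a0|a0] := leP 0 a; first by rewrite ger0_norm// sublinearZ.
  rewrite ltr0_norm// -bp_normN -scaleNr; apply: sublinearZ => //.
  by rewrite oppr_ge0 ltW.
have [k k0 /(_ x)] := bp_norm_ge.
by rewrite x0 pmulr_rle0// normr_le0 => /eqP.
Qed.

Lemma bp_norm_equivalent : equivalent_norms bp_norm (@Num.norm R Y).
Proof.
have [k k0 hk] := bp_norm_ge; have [K K0 hK] := bp_norm_le.
by exists k, K.
Qed.

(** On [C] the first branch reduces to [f y], and the second is at most [- f y + c * |y|], hence
    nonpositive. *)
Lemma bp_norm_cone y : C y -> bp_norm y <= f y.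
Proof.
move=> Cy; rewrite ge_max cone_dist0// mulr0 addr0 lexx/=.
have := fC y Cy; have : c * cone_dist (- y) <= c * `|y|.
  by rewrite ler_pM2l// -normrN cone_dist_le_norm.
have : 0 <= c * `|y| by rewrite mulr_ge0// ltW.
lra.
Qed.

Lemma bp_norm_dist y : f y + c * cone_dist y <= bp_norm y.
Proof. by rewrite le_max lexx. Qed.

End BishopPhelpsNorm.

(** * The algebraic interior of a Bishop-Phelps cone *)

Section Core.
Context {R : realType} {Y : normedModType R}.

(** A strict inequality survives small moves in any direction. Conversely, a core point can be moved
    a little along [- w] inside the cone, and going back along [w] gains a strict amount. *)
Lemma cor_bp_cone (psi : Y -> R) (f : dual Y) alpha w : is_norm psi ->
  0 <= alpha -> bp_cone_strict psi f alpha w ->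
  bp_cone_strict psi f alpha = cor (bp_cone psi f alpha).
Proof.
move=> [pD pZ p0] a0 fw; apply/seteqP; split=> x; rewrite /bp_cone_strict/=.
  move=> fx; split=> [|v]; first exact: ltW.
  pose m := `|f v| + alpha * psi v.
  have psi0 : 0 <= psi v.
    have := pD v (- v); rewrite subrr -scaleN1r pZ normrN1 mul1r.
    by rewrite -(scale0r 0) pZ normr0 mul0r; lra.
  have m0 : 0 <= m by rewrite addr_ge0// mulr_ge0.
  have m1 : 0 < m + 1 by rewrite ltr_wpDl.
  (* [m] bounds the rate at which [f - alpha * psi] can drop along [v]; dividing by [m + 1] covers
     [m = 0]. *)
  exists ((f x - alpha * psi x) / (m + 1)).
    by rewrite divr_gt0// subr_gt0.
  move=> t t0; rewrite ler_pdivlMr// /bp_cone/= => tm.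
  have -> : f (x + t *: v) = f x + t * f v by rewrite linearD linearZ.
  have : alpha * psi (x + t *: v) <= alpha * (psi x + t * psi v).
    by rewrite ler_wpM2l// (le_trans (pD _ _))// pZ ger0_norm.
  have : - `|f v| <= f v by have := ler_norm (- f v); rewrite normrN; lra.
  move=> /(ler_wpM2l t0).
  by move: tm; rewrite /m; lra.
move=> [_ /(_ (- w))[e e0 /(_ e (ltW e0) (lexx e))]].
rewrite /bp_cone/=.
have -> : f (x + e *: - w) = f x - e * f w.
  by rewrite linearD scalerN linearN linearZ.
rewrite scalerN => xw.
have : alpha * psi x <= alpha * (psi (x - e *: w) + e * psi w).
  rewrite ler_wpM2l// -[x in leLHS](subrK (e *: w)) (le_trans (pD _ _))//.
  by rewrite pZ gtr0_norm.
have : e * (alpha * psi w) < e * f w by rewrite ltr_pM2l.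
by move: xw; lra.
Qed.

End Core.

(** * Norm-bases, the angle between two cones, and the choice of [alpha] *)

Section Main.
Context {R : realType} {Y : normedModType R}.
Implicit Types (K A C S P : set Y) (x y z a s : Y).

Lemma is_coneN K : is_cone K -> is_cone (-%R @` K).
Proof.
move=> cK; have [K0 _] := cK; split; first by exists 0; rewrite ?oppr0.
apply/seteqP; split=> [_ [t t0 [_ [x Kx <-] <-]]|x Kx].
  by rewrite scalerN; exists (t *: x) => //; exact: is_cone_scale.
by exists 1 => //=; exists x; rewrite ?scale1r.
Qed.

Lemma norm_base_conv_le1 P s : norm_base_conv P (@Num.norm R Y) s -> `|s| <= 1.
Proof.
move: s; apply: convex_hull_min => [s [_ ->]//|x y t t0 t1 x1 y1].
rewrite (le_trans (ler_normD _ _))// !normrZ !ger0_norm// ?subr_ge0//.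
have := ler_wpM2l t0 x1; have : (1 - t) * `|y| <= (1 - t) * 1.
  by rewrite ler_wpM2l// subr_ge0.
lra.
Qed.

Lemma norm_base_normalize P x : is_cone P -> P x -> x != 0 ->
  norm_base P (@Num.norm R Y) (`|x|^-1 *: x).
Proof.
move=> cP Px x0; split; first by apply: is_cone_scale => //; rewrite invr_ge0.
by rewrite normrZ normfV normr_id mulVf// normr_eq0.
Qed.

Lemma cone_of_norm_base_conv P x : is_cone P -> P x -> x != 0 ->
  cone_of (norm_base_conv P (@Num.norm R Y)) x.
Proof.
move=> cP Px x0; exists `|x| => //; exists (`|x|^-1 *: x).
  by apply: convex_hull_sub; exact: norm_base_normalize.
by rewrite scalerA mulfV ?normr_eq0// scale1r.
Qed.

Lemma norm_base_conv_sub P :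
  norm_base_conv P (@Num.norm R Y) `<=` convex_hull P.
Proof.
apply: convex_hull_min => [x [Px _]|x y t t0 t1]; first exact: convex_hull_sub.
exact: convex_convex_hull.
Qed.

Lemma compact_base_angle A P : is_cone A -> is_cone P ->
  A `&` closure (convex_hull P) = [set 0] ->
  compact (norm_base A (@Num.norm R Y)) ->
  exists2 e, 0 < e & forall a z, A a ->
    cone_of (norm_base_conv P (@Num.norm R Y)) z -> e * `|a| <= `|a - z|.
Proof.
move=> cA cP AP cB; have [] := compact_separation _ (convex_hull P) cB.
  move=> b [Ab b1] Pb; have : (A `&` closure (convex_hull P)) b by [].
  by rewrite AP => /= b0; move/eqP: b1; rewrite b0 normr0 eq_sym oner_eq0.
move=> e e0 eAP; exists e => // a z Aa [t t0 [s Ss ->]].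
have [->|a0] := eqVneq a 0; first by rewrite normr0 mulr0.
have na : 0 < `|a| by rewrite normr_gt0.
have := eAP _ (`|a|^-1 *: (t *: s)) (norm_base_normalize _ _ cA Aa a0).
rewrite -scalerBr normrZ normfV normr_id ler_pdivlMl// mulrC; apply.
rewrite scalerA; apply: convex_hull_scale; last exact: norm_base_conv_sub.
by move=> x; apply: is_cone_scale => //; rewrite mulr_ge0// invr_ge0.
Qed.

(** Scaling the separation gives [t * d <= |a - t *: s|], while [|a| <= |a - t *: s| + t];
    eliminating [t] yields the constant [d / (1 + d)]. *)
Lemma separated_angle A S d : is_cone A -> 0 < d ->
  (forall s, S s -> `|s| <= 1) ->
  (forall a s, A a -> S s -> d <= `|a - s|) ->
  exists2 e, 0 < e & forall a z, A a -> cone_of S z -> e * `|a| <= `|a - z|.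
Proof.
move=> cA d0 S1 dAS; have d1 : 0 < 1 + d by rewrite addr_gt0.
exists (d / (1 + d)); first by rewrite divr_gt0.
move=> a _ Aa [t t0 [s Ss ->]]; rewrite mulrAC ler_pdivrMr//.
have tsd : t * d <= `|a - t *: s|.
  move: t0; rewrite le_eqVlt => /predU1P[<-|t0]; first by rewrite mul0r.
  have ta : A (t^-1 *: a) by apply: is_cone_scale => //; rewrite invr_ge0 ltW.
  have := dAS _ _ ta Ss; rewrite -[in X in X -> _](ler_pM2l t0).
  move=> /le_trans; apply.
  rewrite -{1}(gtr0_norm t0) -normrZ scalerBr scalerA mulfV ?scale1r//.
  exact: lt0r_neq0.
have ts : `|t *: s| <= t by rewrite normrZ ger0_norm// ler_piMr// S1.
have := ler_normD (a - t *: s) (t *: s); rewrite subrK => h.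
have : d * `|a| <= d * (`|a - t *: s| + t) by rewrite ler_pM2l//; lra.
lra.
Qed.

Lemma bp_norm_separation A P C (f : dual Y) c e :
  (forall x, P x -> x != 0 -> C x) ->
  convex_cone C -> 0 < c -> (forall y, C y -> c * `|y| <= f y) ->
  0 < e -> (forall a z, A a -> C z -> e * `|a| <= `|a - z|) ->
  exists2 alpha, 0 < alpha &
    (forall y, P y -> y != 0 -> alpha * bp_norm C f c y < f y) /\
    (forall a, A a -> a != 0 -> f a < alpha * bp_norm C f c a).
Proof.
move=> PC cC c0 fC e0 eAC; have [L L0 fL] := dual_bound f.
have ce : 0 < c * e by rewrite mulr_gt0.
have D0 : 0 < 2 * L + c * e by rewrite addr_gt0// mulr_gt0.
(* On [A] the goal reduces to [(1 - al) * f a < al * c * e * |a|]. With this [al] the right side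
   equals [(1 - al) * 2 * L * |a|], and the factor 2 makes the inequality strict. *)
pose al := 2 * L / (2 * L + c * e).
have al0 : 0 < al by rewrite divr_gt0// mulr_gt0.
have al1 : al < 1 by rewrite ltr_pdivrMr// mul1r ltrDl.
exists al => //; split=> [y Py y0|a Aa a0].
  have Cy := PC y Py y0.
  have fy : 0 < f y.
    by apply: lt_le_trans (fC y Cy); rewrite mulr_gt0// normr_gt0.
  apply: le_lt_trans (_ : al * f y < f y); last by rewrite gtr_pMl.
  by rewrite ler_pM2l// bp_norm_cone.
have na : 0 < `|a| by rewrite normr_gt0.
apply: lt_le_trans (_ : al * (f a + c * (e * `|a|)) <= _); last first.
  rewrite ler_pM2l//; apply: le_trans (bp_norm_dist C f c a).
  by rewrite lerD2l ler_pM2l//; apply: cone_dist_ge => // z Cz; exact: eAC.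
rewrite mulrDr -ltrBlDl -[X in X - _]mul1r -mulrBl.
have -> : 1 - al = c * e / (2 * L + c * e).
  by rewrite /al; field; exact: lt0r_neq0.
have -> : al * (c * (e * `|a|)) = c * e / (2 * L + c * e) * (2 * L * `|a|).
  by rewrite /al; field; exact: lt0r_neq0.
rewrite ltr_pM2l ?divr_gt0//; have := fL a; have := ler_norm (f a).
have := mulr_gt0 L0 na; lra.
Qed.

End Main.

Theorem corollary28 (R : realType) (Y : normedModType R) (K A : set Y)
  (dimY : dim_ge2 Y)
  (coneK : is_cone K) (ntK : nontrivial K)
  (coneA : is_cone A) (ntA : nontrivial A)
  (wcS : weakly_compact (closure (norm_base_conv (-%R @` K) (@Num.norm R Y))))
  (AK : A `&` closure (convex_hull (-%R @` K)) = [set 0])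
  (S0 : ~ closure (norm_base_conv (-%R @` K) (@Num.norm R Y)) 0)
  (ab : compact (norm_base A (@Num.norm R Y)) \/
        (weakly_closed A /\
         (reflexive_space Y \/
          (weakly_compact (weak_closure (norm_base A (@Num.norm R Y))) /\
           ~ weak_closure (norm_base A (@Num.norm R Y)) 0)))) :
  exists psi : Y -> R, [/\ is_norm psi, equivalent_norms psi (@Num.norm R Y) &
    exists (xstar : dual Y) (alpha : R),
      [/\ aug_dual_cone K psi (xstar, alpha), 0 < alpha,
          A `&` (-%R @` bp_cone psi xstar alpha) = [set 0],
          K `\ 0 `<=` bp_cone_strict psi xstar alpha
        & bp_cone_strict psi xstar alpha = cor (bp_cone psi xstar alpha)]].
Proof.
set P := -%R @` K in wcS AK S0 *; have coneP : is_cone P by exact: is_coneN.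
set S := norm_base_conv P _ in wcS S0 *; pose C := cone_of S.
(* This [k] serves twice: it makes [S] nonempty, and it is the point of the strict cone required by
   [cor_bp_cone]. *)
have [k Kk k0] : exists2 k, K k & k != 0.
  apply: contrapT => noK; case: ntK => + _; apply; apply/seteqP.
  split=> [_ ->|x Kx]; first by case: coneK.
  by apply: contrapT => /eqP x0; apply: noK; exists x.
have PN x : K x -> P (- x) by exists x.
have PC x : P x -> x != 0 -> C x by exact: cone_of_norm_base_conv.
have cS : @convex_set R Y S.
  by apply/convex_setP => x y t; exact: convex_convex_hull.
have Sn : S !=set0.
  have /PC : P (- k) by exact: PN.
  by rewrite oppr_eq0 => /(_ k0)[t _ [s Ss _]]; exists s.
have [d d0 dS] := closureNE _ _ S0.
have {dS}dS s : S s -> d <= `|s| by move=> /dS; rewrite sub0r normrN.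
have [f fS] := convex_separation0 S d cS dS.
(* The bound [d] on [S] becomes [d * |y|] on the cone, since [S] lies in the unit ball. *)
have fC y : C y -> d * `|y| <= f y.
  move=> [t t0 [s Ss ->]]; rewrite normrZ ger0_norm// linearZ/=.
  rewrite mulrCA ler_wpM2l// (le_trans _ (fS s Ss))//.
  by rewrite ler_piMr ?(ltW d0)//; exact: (norm_base_conv_le1 P).
have cC : convex_cone C by exact: convex_cone_cone_of.
have [e e0 eAC] : exists2 e, 0 < e &
    forall a z, A a -> C z -> e * `|a| <= `|a - z|.
  case: ab => [|[wcA _]]; first exact: compact_base_angle.
  have [|r r0 rAS] := weak_separation _ _ wcS wcA.
    (* By [AK] a common point of [A] and the closure of [S] can only be 0, which [S0] excludes. *)
    apply/seteqP; split=> // x [Ax Sx]; apply: S0.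
    suff <- : x = 0 by [].
    have : (A `&` closure (convex_hull P)) x.
      by split=> //; apply: closureS Sx; exact: norm_base_conv_sub.
    by rewrite AK.
  apply: separated_angle coneA r0 (@norm_base_conv_le1 _ _ P) _ => a s Aa Ss.
  by apply: rAS => //; exact: subset_closure.
have [al al0 [alP alA]] := bp_norm_separation A P C f d e PC cC d0 fC e0 eAC.
have psiN := bp_normN C f d.
(* As [P] is [- K] and the new norm is even, the estimate on [P] for [f] becomes one on [K] for
   [- f]. *)
have alK x : K x -> x != 0 -> al * bp_norm C f d x < (- f) x.
  move=> Kx x0; have := alP (- x) (PN x Kx).
  by rewrite oppr_eq0 psiN linearN; exact.
have psin := bp_norm_is_norm C f d cC d0 fC.
exists (bp_norm C f d); split=> //; first exact: bp_norm_equivalent.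
exists (- f), al; split=> //.
- split=> [|y [Ky /eqP y0]]; first exact: ltW.
  by rewrite /= subr_gt0 alK.
- apply/seteqP; split=> [a [Aa [x + xa]]|_ ->].
    rewrite /bp_cone/= => fx; apply: contrapT => /eqP a0.
    have := alA _ Aa a0; rewrite -xa linearN psiN => /lt_le_trans/(_ fx).
    by rewrite ltxx.
  split; first by case: coneA.
  exists 0; last exact: oppr0.
  apply: (le_trans _ (_ : 0 <= (- f) 0)); last by rewrite (linear0 (- f)).
  rewrite sublinear0 ?mulr0//.
  exact: bp_norm_sublinear.
- by move=> x [Kx /eqP x0]; exact: alK.
- apply: (cor_bp_cone _ _ _ k) => //; first exact: ltW.
  exact: alK.
Qed.
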